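(* Let $I, K \subseteq A$ and $J, L \subseteq B$ be ideals. For any integer $s \ge 1$, we have the following equality of ideals of $R = A\otimes_{\Bbbk} B$: $$(I+J)^{(s)}_{KL}=\sum_{i=0}^s I^{(i)}_K\, J^{(s-i)}_L .$$
   Context: Throughout, $\Bbbk$ is a field, and $A$ and $B$ are Noetherian commutative $\Bbbk$-algebras such that $R = A\otimes_{\Bbbk} B$ is also Noetherian. Ideals of $A$ and of $B$ are identified with their extensions to $R$ when they appear in expressions in $R$: for ideals $\mathfrak{a}\subseteq A$ and $\mathfrak{b}\subseteq B$, $\mathfrak{a}+\mathfrak{b}$ means $\mathfrak{a}R+\mathfrak{b}R$ and $\mathfrak{a}\mathfrak{b}$ means $(\mathfrak{a}R)(\mathfrak{b}R)$. For ideals $\mathfrak{a},\mathfrak{c}$ in a commutative ring $S$ and an integer $s\ge 0$, the $s$-th saturated power of $\mathfrak{a}$ with respect to $\mathfrak{c}$ is the ideal $\mathfrak{a}^{(s)}_{\mathfrak{c}} := \mathfrak{a}^s : \mathfrak{c}^\infty = \bigcup_{t\ge 1} (\mathfrak{a}^s :_S \mathfrak{c}^t)$ of $S$, where $\mathfrak{a}^0=S$; in particular $\mathfrak{a}^{(0)}_{\mathfrak{c}}=S$. Thus $I^{(i)}_K$ is computed in $A$, $J^{(j)}_L$ in $B$, and $(I+J)^{(s)}_{KL}$ in $R$. *)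

(* Defs.v *)
From mathcomp Require Import all_boot all_algebra.
From mathcomp Require Import boolp classical_sets.

Set Implicit Arguments.
Unset Strict Implicit.
Unset Printing Implicit Defensive.

Import GRing.Theory.

Local Open Scope classical_set_scope.
Local Open Scope ring_scope.

(* [ring_quotient.idealr] only covers proper decidable ideals, and R itself
   (e.g. as the power a^0) has to be an ideal here. *)
Section Ideals.
Variable R : comPzRingType.
Implicit Types (G I J : set R).

Definition is_ideal I : Prop :=
  [/\ I 0, forall x y, I x -> I y -> I (x + y)
    & forall a x, I x -> I (a * x)].

Definition ideal_gen G : set R := smallest is_ideal G.

Definition idealD I J : set R := [set x + y | x in I & y in J].

Definition idealM I J : set R := ideal_gen [set x * y | x in I & y in J].

Definition idealX I (n : nat) : set R := iter n (idealM I) setT.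

Definition ideal_colon I J : set R := [set x | forall y, J y -> I (x * y)].

Definition saturation I J : set R :=
  \bigcup_(t in [set t | (1 <= t)%N]) ideal_colon I (idealX J t).

Definition saturated_power I J (s : nat) : set R := saturation (idealX I s) J.

Definition noetherian : Prop :=
  forall I, is_ideal I -> exists gs : seq R, I = ideal_gen [set` gs].

End Ideals.

Arguments noetherian R : clear implicits.

Definition ideal_ext (S R : comPzRingType) (f : {rmorphism S -> R})
  (I : set S) : set R := ideal_gen (f @` I).

(* Commutative algebras over k, given by their structure morphism.  Unlike
   [comAlgType k], this does not exclude the zero algebra. *)
Structure comKAlg (k : fieldType) := ComKAlg {
  kalg_ring :> comPzRingType;
  kalg_map : {rmorphism k -> kalg_ring} }.

Section TensorProduct.
Variables (k : fieldType) (A B R : comKAlg k).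
Variables (iA : {rmorphism A -> R}) (iB : {rmorphism B -> R}).

Definition klinear (M : lmodType k) (g : R -> M) : Prop :=
  forall c x y, g (kalg_map R c * x + y) = c *: g x + g y.

Definition kbilinear (M : lmodType k) (f : A -> B -> M) : Prop :=
  (forall c a a' b, f (kalg_map A c * a + a') b = c *: f a b + f a' b) /\
  (forall c a b b', f a (kalg_map B c * b + b') = c *: f a b + f a b').

(* R is the tensor product of A and B over k, with a (x) b = iA a * iB b:
   iA and iB are morphisms of k-algebras, and (a, b) |-> iA a * iB b is
   universal among the k-bilinear maps from A x B to k-modules.  Since iA and
   iB are ring morphisms, this also fixes the product of R:
   (a (x) b) * (a' (x) b') = (a * a') (x) (b * b'). *)
Definition is_tensor_product : Prop :=
  [/\ forall c, iA (kalg_map A c) = kalg_map R c,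
      forall c, iB (kalg_map B c) = kalg_map R c
    & forall (M : lmodType k) (f : A -> B -> M), kbilinear f ->
        exists! g : R -> M,
          klinear g /\ (forall a b, g (iA a * iB b) = f a b)].

End TensorProduct.

(* Main.v *)
Require Import Defs.
From mathcomp Require Import all_boot all_algebra.
From mathcomp Require Import boolp classical_sets.
From HB Require Import structures.
From mathcomp Require Import ring zify.

Import GRing.Theory.
Local Open Scope classical_set_scope.
Local Open Scope ring_scope.

(** Both sides are compared with sums of pure tensors a (x) b = iA a * iB b.
Extended ideals, their sums, products and powers all have such descriptions:
(I + J)^s lies in the sum of the I^i J^j with i + j = s, and every element of
(KL)^t is a sum of c (x) d with c in K^t and d in L^t.

Everything rests on one statement on colon ideals
([colon_product_filtration]). Let A_i and B_j be decreasing sequences of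
ideals of A and B with B_0 = B, and let C be a subset of A. If x in R satisfies
C x <= sum_(i + j = s) A_i B_j, then x lies in sum_(i + j = s) (A_i : C) B_j.
This is linear algebra over k: with a basis of B adapted to the filtration
B_0 >= ... >= B_s, the condition can be read on the coordinates of x. Instead
of a basis, the proof enlarges subspaces U of B one vector b at a time,
proving the statement for x in A (x) U. If x = u + a (x) b with u in A (x) U
and b in B_d, where U contains B_j for all d < j <= s, then a linear form on B
that kills U and takes the value 1 at b ([functional_exists]) shows that a is in
A_(s - d) : C; so a (x) b is of the required form and can be removed from x.

Now let x (KL)^t be contained in (I + J)^s. For d in L^t, the statement on
colon ideals with C = K^t puts d x in the sum of the (I^i : K^t) J^j. Applied
once more, with A and B exchanged and C = L^t, it puts x in the sum of the
(I^i : K^t) (J^j : L^t). The other inclusion is a direct computation. *)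

Set Implicit Arguments.

(** * Ideals and their powers *)

Section IdealTheory.
Variable R : comPzRingType.
Implicit Types (G I J : set R).

Lemma ideal_sub {I} x y : is_ideal I -> I x -> I y -> I (x - y).
Proof. by case=> _ ID IM Ix Iy; apply: ID => //; rewrite -mulN1r; apply: IM. Qed.

Lemma is_ideal_set0 : is_ideal [set 0 : R].
Proof.
by split=> [//|x y /= -> ->|a x /= ->]; rewrite ?addr0 ?mulr0.
Qed.

Lemma is_ideal_setT : is_ideal [set: R].
Proof. by split. Qed.

Lemma ideal_gen_is_ideal G : is_ideal (ideal_gen G).
Proof.
split=> [M [[]] //|x y Gx Gy M MG|a x Gx M MG].
  by case: (MG) => -[_ MD _] _; apply: MD; [apply: Gx | apply: Gy].
by case: (MG) => -[_ _ MM] _; apply: MM; apply: Gx.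
Qed.

Lemma is_ideal_idealX I n : is_ideal (idealX I n).
Proof.
by case: n => [|n]; [apply: is_ideal_setT | apply: ideal_gen_is_ideal].
Qed.

Lemma is_ideal_idealD I J : is_ideal I -> is_ideal J -> is_ideal (idealD I J).
Proof.
move=> [I0 ID IM] [J0 JD JM]; split.
- by exists 0 => //; exists 0 => //; rewrite addr0.
- move=> _ _ [x Ix [y Jy <-]] [x' Ix' [y' Jy' <-]].
  by exists (x + x'); [apply: ID | exists (y + y'); [apply: JD | ring]].
- move=> a _ [x Ix [y Jy <-]].
  by exists (a * x); [apply: IM | exists (a * y); [apply: JM | ring]].
Qed.

Lemma is_ideal_colon I J : is_ideal I -> is_ideal (ideal_colon I J).
Proof.
move=> [I0 ID IM]; split=> [y _|x x' Cx Cx' y Jy|a x Cx y Jy].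
- by rewrite mul0r.
- by rewrite mulrDl; apply: ID; [apply: Cx | apply: Cx'].
- by rewrite -mulrA; apply: IM; apply: Cx.
Qed.

Lemma sub_ideal_gen {G I} : is_ideal I -> G `<=` I -> ideal_gen G `<=` I.
Proof. exact: smallest_sub. Qed.

Lemma mem_ideal_gen {G} x : G x -> ideal_gen G x.
Proof. exact: sub_gen_smallest. Qed.

Lemma mem_idealM {I J} x y : I x -> J y -> idealM I J (x * y).
Proof. by move=> Ix Jy; apply: mem_ideal_gen; exists x => //; exists y. Qed.

Lemma sub_idealM {I J M} : is_ideal M ->
  (forall x y, I x -> J y -> M (x * y)) -> idealM I J `<=` M.
Proof.
by move=> idM IJM; apply: sub_ideal_gen => // _ [x Ix [y Jy <-]]; apply: IJM.
Qed.

Lemma idealXS_sub I n : idealX I n.+1 `<=` idealX I n.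
Proof.
have [_ _ nM] := is_ideal_idealX I n.
by apply: sub_idealM => [|x y _]; [apply: is_ideal_idealX | apply: nM].
Qed.

Lemma idealX_sub I m n : (m <= n)%N -> idealX I n `<=` idealX I m.
Proof.
move=> /subnK <-; elim: (n - m)%N => [//|d IHd] x /idealXS_sub.
exact: IHd.
Qed.

Lemma mem_idealX_mul {I} m n x y :
  idealX I m x -> idealX I n y -> idealX I (m + n) (x * y).
Proof.
elim: m x => [|m IHm] x.
  by move=> _ ny; have [_ _ nM] := is_ideal_idealX I n; apply: nM.
have [S0 SD SM] := is_ideal_idealX I (m.+1 + n).
move=> + ny; move: x.
apply: (@sub_idealM _ _ [set x | idealX I (m.+1 + n) (x * y)]).
  split=> [|x x' /= ? ?|a x /= ?]; first by rewrite /= mul0r.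
    by rewrite mulrDl; apply: SD.
  by rewrite -mulrA; apply: SM.
by move=> u v Iu mv /=; rewrite -mulrA; apply: mem_idealM => //; apply: IHm.
Qed.

Lemma is_ideal_saturated_power I J s : is_ideal (saturated_power I J s).
Proof.
have [S0 SD SM] := is_ideal_idealX I s.
split.
- by exists 1%N => // y _; rewrite mul0r.
- move=> x y [t t1 Cx] [u u1 Cy]; exists (maxn t u).
    by rewrite /= leq_max (t1 : (1 <= t)%N).
  move=> z Jz; rewrite mulrDl; apply: SD.
    by apply: Cx; apply: idealX_sub Jz; rewrite leq_maxl.
  by apply: Cy; apply: idealX_sub Jz; rewrite leq_maxr.
- move=> a x [t t1 Cx]; exists t => // y Jy.
  by rewrite -mulrA; apply: SM; apply: Cx.
Qed.

Lemma is_ideal_big_idealD n (G : 'I_n -> set R) :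
  (forall i, is_ideal (G i)) -> is_ideal (\big[@idealD R/[set 0]]_(i < n) G i).
Proof.
move=> idG; apply: big_ind => [|U V|i _]; last exact: idG.
  exact: is_ideal_set0.
exact: is_ideal_idealD.
Qed.

Lemma sub_big_idealD n (G : 'I_n -> set R) : (forall i, is_ideal (G i)) ->
  forall i, G i `<=` \big[@idealD R/[set 0]]_(i < n) G i.
Proof.
elim: n G => [|n IHn] G idG i x Gx; first by case: i Gx.
have [S0 _ _] := is_ideal_big_idealD _ (fun j => idG (lift ord0 j)).
rewrite big_ord_recl; case: (unliftP ord0 i) Gx => [j|] -> Gx; last first.
  by exists x => //; exists 0; rewrite ?addr0.
exists 0; first by case: (idG ord0).
exists x; last by rewrite add0r.
exact: (IHn (fun i => G (lift ord0 i)) (fun i => idG _) j).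
Qed.

Lemma big_idealD_sub n (G : 'I_n -> set R) M : is_ideal M ->
  (forall i, G i `<=` M) -> \big[@idealD R/[set 0]]_(i < n) G i `<=` M.
Proof.
move=> [M0 MD _] GM.
apply: (big_ind (fun X => X `<=` M)) => [x -> //|U V UM VM _ [x Ux [y Vy <-]]|//].
by apply: MD; [apply: UM | apply: VM].
Qed.

End IdealTheory.

Arguments ideal_gen_is_ideal {R} G.
Arguments is_ideal_idealX {R} I n.
Arguments is_ideal_saturated_power {R} I J s.

(** * Separating a vector from a subspace *)

Section Functionals.
Variables (k : fieldType) (V : comKAlg k).

(** A subset of the algebra [V] that is a vector subspace over [k]. *)
Definition subspace (U : set V) : Prop :=
  U 0 /\ forall c x y, U x -> U y -> U (kalg_map V c * x + y).

Lemma subspaceD {U} x y : subspace U -> U x -> U y -> U (x + y).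
Proof.
by move=> [_ UL] Ux Uy; have := UL 1 _ _ Ux Uy; rewrite rmorph1 mul1r.
Qed.

Lemma subspaceZ {U} c x : subspace U -> U x -> U (kalg_map V c * x).
Proof.
by move=> [U0 UL] Ux; have := UL c _ _ Ux U0; rewrite addr0.
Qed.

Lemma ideal_subspace (I : set V) : is_ideal I -> subspace I.
Proof. by move=> [I0 ID IM]; split=> // c x y Ix Iy; apply: ID => //; apply: IM. Qed.

Lemma subspace_line {U} e : subspace U ->
  subspace [set x | exists u l, U u /\ x = u + kalg_map V l * e].
Proof.
move=> sU; have [U0 UL] := sU; split.
  by exists 0, 0; split=> //; rewrite rmorph0; ring.
move=> c _ _ [u [l [Uu ->]]] [v [m [Uv ->]]].
exists (kalg_map V c * u + v), (c * l + m); split; first exact: UL.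
by rewrite rmorphD rmorphM; ring.
Qed.

(** A maximal subspace H that contains U but not e is a hyperplane with
V = H + k e; the form is the coefficient along e. *)
Lemma functional_exists U e : subspace U -> ~ U e ->
  exists phi : V -> k^o,
    [/\ klinear phi, phi e = 1 & forall u, U u -> phi u = 0].
Proof.
move=> sU Ue; have [U0 UL] := sU.
(* Zorn's lemma also ranges over the empty chain, whose union is empty;
   hence U is adjoined to every member. *)
pose P (X : set V) := subspace (U `|` X) /\ ~ (U `|` X) e.
have [F FP totF|H [[sH He] Hmax]] := @Zorn_bigcup _ P.
  split; last by move=> [//|[X /FP [_ Xe] ?]]; apply: Xe; right.
  have mem X x y c : F X -> (U `|` X) x -> (U `|` X) y ->
      (U `|` \bigcup_(X in F) X) (kalg_map V c * x + y).
    move=> FX Xx Xy; have [[_ XL] _] := FP _ FX.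
    by case: (XL c _ _ Xx Xy) => ?; [left | right; exists X].
  split=> [|c x y [Ux|[X FX Xx]] [Uy|[Y FY Yy]]]; first by left.
  - by left; apply: UL.
  - by apply: (mem Y) => //; [left | right].
  - by apply: (mem X) => //; [right | left].
  - case: (totF _ _ FX FY) => [XY|YX].
      by apply: (mem Y) => //; right=> //; apply: XY.
    by apply: (mem X) => //; right=> //; apply: YX.
set W := U `|` H in sH He.
have [W0 WL] := sH.
(* If x is not in W, then W + k x contains e by maximality. *)
have dec x : exists l, W (x - kalg_map V l * e).
  have [Wx|nWx] := pselect (W x).
    by exists 0; rewrite rmorph0 mul0r subr0.
  pose X := [set y | exists u l, W u /\ y = u + kalg_map V l * x].
  have WX : W `<=` X.
    by move=> u Wu; exists u, 0; split=> //; rewrite rmorph0; ring.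
  have UX : U `|` X = X by apply/setUidPr => u Uu; apply: WX; left.
  have [Xe|nXe] := pselect (X e); last first.
    have HX : H `<` X.
      split=> [u Hu|XH]; first by apply: WX; right.
      by apply: nWx; right; apply: XH; exists 0, 1; split=> //; rewrite rmorph1; ring.
    by case: (Hmax _ HX); split; rewrite UX //; apply: subspace_line.
  have [u [l [Wu eE]]] := Xe.
  have l0 : l != 0.
    by apply/eqP => l0; apply: He; rewrite eE l0 rmorph0 mul0r addr0.
  exists l^-1; have := subspaceZ (- l^-1) _ sH Wu.
  suff -> : x = kalg_map V l^-1 * (kalg_map V l * x).
    by congr W; rewrite eE rmorphN; ring.
  by rewrite mulrA -rmorphM mulVf // rmorph1 mul1r.
(* As e is not in W, the scalar found by [dec] is unique, hence linear in x. *)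
have uniq x l m : W (x - kalg_map V l * e) -> W (x - kalg_map V m * e) -> l = m.
  move=> Wl Wm; apply/eqP; rewrite -subr_eq0; apply/negPn/negP => lm.
  apply: He; have := subspaceZ (l - m)^-1 _ sH (WL (-1) _ _ Wl Wm).
  suff -> : kalg_map V (-1) * (x - kalg_map V l * e) + (x - kalg_map V m * e)
            = kalg_map V (l - m) * e.
    by rewrite mulrA -rmorphM mulVf // rmorph1 mul1r.
  by rewrite rmorphN rmorph1 rmorphB; ring.
have [phi phiP] := choice dec.
exists phi; split.
- move=> c x y; apply: uniq (phiP _) _.
  have := WL c _ _ (phiP x) (phiP y); congr W.
  by rewrite rmorphD rmorphM; ring.
- by apply: uniq (phiP e) _; rewrite rmorph1 mul1r subrr.
- by move=> u Uu; apply: uniq (phiP u) _; rewrite rmorph0 mul0r subr0; left.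
Qed.

End Functionals.

Arguments subspace {k V} U.

(** * Sums of pure tensors *)

(** The ring of [V], seen as a [k]-module: a name of its own for the carrier,
to which the module structure can be attached. *)
Definition kmod {k : fieldType} (V : comKAlg k) : Type := kalg_ring V.

Section KMod.
Variables (k : fieldType) (V : comKAlg k).

HB.instance Definition _ := GRing.Zmodule.copy (kmod V) (kalg_ring V).

Definition kmod_scale (c : k) (v : kmod V) : kmod V :=
  kalg_map V c * (v : kalg_ring V).

Fact kmod_scaleA a b v : kmod_scale a (kmod_scale b v) = kmod_scale (a * b) v.
Proof. by rewrite /kmod_scale rmorphM mulrA. Qed.

Fact kmod_scale1 : left_id 1 kmod_scale.
Proof. by move=> v; rewrite /kmod_scale rmorph1 mul1r. Qed.

Fact kmod_scaleDr : right_distributive kmod_scale +%R.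
Proof. by move=> c u v; rewrite /kmod_scale mulrDr. Qed.

Fact kmod_scaleDl v : {morph kmod_scale^~ v : a b / a + b}.
Proof. by move=> a b; rewrite /kmod_scale rmorphD mulrDl. Qed.

HB.instance Definition _ := GRing.Zmodule_isLmodule.Build k (kmod V)
  kmod_scaleA kmod_scale1 kmod_scaleDr kmod_scaleDl.

Lemma kmod_scaleE c (v : kmod V) : c *: v = kalg_map V c * (v : kalg_ring V).
Proof. by []. Qed.

End KMod.

(** Closure under finite sums. *)
Definition sum_closed {R : comPzRingType} (S : set R) : Prop :=
  S 0 /\ forall x y, S x -> S y -> S (x + y).

Section Tensors.
Variables (k : fieldType) (A B R : comKAlg k).
Variables (iA : {rmorphism A -> R}) (iB : {rmorphism B -> R}).
Implicit Types P Q : A -> B -> Prop.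

(** The set of finite sums of the pure tensors a (x) b with P a b, as the
smallest set that contains them and is closed under sums. *)
Definition tensors P : set R :=
  smallest (@sum_closed R) [set x | exists a b, P a b /\ x = iA a * iB b].

Lemma tensors_pure P a b : P a b -> tensors P (iA a * iB b).
Proof. by move=> Pab; apply: sub_gen_smallest; exists a, b. Qed.

Lemma tensors_sum_closed P : sum_closed (tensors P).
Proof.
split=> [M [[]] //|x y Px Py M MP].
by case: (MP) => -[_ MD] _; apply: MD; [apply: Px | apply: Py].
Qed.

Lemma tensors_ind {P} (S : set R) : sum_closed S ->
  (forall a b, P a b -> S (iA a * iB b)) -> tensors P `<=` S.
Proof. by move=> sS PS; apply: smallest_sub => // _ [a [b [? ->]]]; apply: PS. Qed.

Lemma ideal_sum_closed (S : set R) : is_ideal S -> sum_closed S.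
Proof. by case. Qed.

Lemma sub_tensors {P Q} : (forall a b, P a b -> Q a b) -> tensors P `<=` tensors Q.
Proof.
move=> PQ; apply: tensors_ind; first exact: tensors_sum_closed.
by move=> a b /PQ; apply: tensors_pure.
Qed.

Lemma tensorsM P Q (T : A -> B -> Prop) x y :
  (forall a b a' b', P a b -> Q a' b' -> T (a * a') (b * b')) ->
  tensors P x -> tensors Q y -> tensors T (x * y).
Proof.
move=> PQT + Qy; have [T0 TD] := tensors_sum_closed T; move: x.
apply: (@tensors_ind _ [set x | tensors T (x * y)]).
  by split=> [|u v /= ? ?]; rewrite /= ?mul0r ?mulrDl //; apply: TD.
move=> a b Pab /=; move: y Qy.
apply: (@tensors_ind _ [set y | tensors T (iA a * iB b * y)]).
  by split=> [|u v /= ? ?]; rewrite /= ?mulr0 ?mulrDr //; apply: TD.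
move=> a' b' Qab /=; rewrite mulrACA -!rmorphM.
by apply: tensors_pure; apply: PQT.
Qed.

Hypothesis tensR : is_tensor_product iA iB.

(** By uniqueness in the universal property, a linear form on [R] vanishing on
the pure tensors is zero; so no element of [R] can be separated from the
subspace of their sums. *)
Lemma tensors_all x : tensors (fun _ _ => True) x.
Proof.
have [kA kB univ] := tensR.
apply: contrapT => nTx.
have [T0 TD] := tensors_sum_closed (fun _ _ => True).
have sT : subspace (tensors (fun _ _ => True)).
  split=> // c u v Tu Tv; apply: TD => //.
  apply: (@tensorsM (fun _ _ => True) (fun _ _ => True)) => //.
  by rewrite -kA -[X in tensors _ X]mulr1 -(rmorph1 iB); apply: tensors_pure.
have [phi [phiL phix phiT]] := functional_exists x sT nTx.
have [|g [_ uniq_g]] := univ k^o (fun _ _ => 0).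
  by split=> *; rewrite scaler0 addr0.
have phig : g = phi.
  by apply: uniq_g; split=> // a b; apply: phiT; apply: tensors_pure.
have zerog : g = fun _ => 0.
  by apply: uniq_g; split=> // c u v; rewrite scaler0 addr0.
have := oner_neq0 k; rewrite -[X in X != _]phix.
by rewrite -phig zerog eqxx.
Qed.

Lemma is_ideal_tensors P :
  (forall a b a' b', P a b -> P (a' * a) (b' * b)) -> is_ideal (tensors P).
Proof.
move=> PM; have [P0 PD] := tensors_sum_closed P; split=> // a x Px.
by apply: (@tensorsM (fun _ _ => True) P) (tensors_all a) Px => *; apply: PM.
Qed.

(** A linear form [phi] on [B] induces the [A]-linear map id (x) phi on [R]. *)
Lemma slice_exists (phi : B -> k^o) : klinear phi ->
  exists g : R -> A,
    [/\ forall x y, g (x + y) = g x + g y,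
        forall c x, g (iA c * x) = c * g x
      & forall a b, g (iA a * iB b) = kalg_map A (phi b) * a].
Proof.
move=> phiL; have [kA kB univ] := tensR.
have bil c : kbilinear (A := A) (B := B) (M := kmod A)
    (fun a b => kalg_map A (phi b) * (c * a)).
  split=> [d a a' b|d a b b']; rewrite kmod_scaleE.
    by ring.
  by rewrite phiL rmorphD -[d *: _]/(d * _) rmorphM; ring.
have [g [[gL gE] _]] := univ (kmod A) _ (bil 1).
exists g; split.
- by move=> x y; have := gL 1 x y; rewrite scale1r rmorph1 mul1r.
(* Both x |-> g (c x) and x |-> c g x extend a (x) b |-> phi(b) c a. *)
- move=> c x.
  have [h [_ uniq_h]] := univ (kmod A) _ (bil c).
  have hg : h = fun x => g (iA c * x).
    apply: uniq_h; split=> [d u v|a b]; first by rewrite mulrDr mulrCA gL.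
    by rewrite mulrA -rmorphM gE mul1r.
  have hg' : h = fun x => c * (g x : A).
    apply: uniq_h; split=> [d u v|a b].
      by rewrite gL !kmod_scaleE mulrDr mulrCA.
    by rewrite gE mul1r mulrCA.
  by have := congr1 (fun f => f x) hg; rewrite hg'.
- by move=> a b; rewrite gE mul1r.
Qed.

End Tensors.

Arguments tensors {k A B R} iA iB P.
Arguments tensors_sum_closed {k A B R} iA iB P.

(** * Colon ideals of sums of products of filtrations *)

(** The generators a (x) b, with a in A_i, b in B_j and i + j = s, of the
s-th term of the product of two filtrations. *)
Definition product_filtration {A B : Type} (A_ : nat -> set A)
    (B_ : nat -> set B) (s : nat) (a : A) (b : B) : Prop :=
  exists i j, [/\ (i + j = s)%N, A_ i a & B_ j b].

Lemma is_ideal_product_filtration (k : fieldType) (A B R : comKAlg k)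
    (iA : {rmorphism A -> R}) (iB : {rmorphism B -> R})
    (A_ : nat -> set A) (B_ : nat -> set B) s :
  is_tensor_product iA iB ->
  (forall i, is_ideal (A_ i)) -> (forall j, is_ideal (B_ j)) ->
  is_ideal (tensors iA iB (product_filtration A_ B_ s)).
Proof.
move=> tensR idA idB.
apply: is_ideal_tensors => // a b a' b' [i [j [ij Aa Bb]]].
exists i, j; split=> //; first by case: (idA i) => _ _; apply.
by case: (idB j) => _ _; apply.
Qed.

Section ColonLeft.
Variables (k : fieldType) (A B R : comKAlg k).
Variables (iA : {rmorphism A -> R}) (iB : {rmorphism B -> R}).
Hypothesis tensR : is_tensor_product iA iB.
Variables (A_ : nat -> set A) (B_ : nat -> set B) (s : nat) (C : set A).
Hypothesis idA : forall i, is_ideal (A_ i).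
Hypothesis idB : forall j, is_ideal (B_ j).
Hypothesis A_decr : forall i j, (i <= j)%N -> A_ j `<=` A_ i.
Hypothesis B_decr : forall i j, (i <= j)%N -> B_ j `<=` B_ i.
Hypothesis B_0 : B_ 0%N = setT.

Let T := tensors iA iB.
Let F := T (product_filtration A_ B_ s).
Let CA i := ideal_colon (A_ i) C.
Let CF := T (product_filtration CA B_ s).
Let tensU (U : set B) := T (fun _ b => U b).

(** The statement on colon ideals, for the elements of A (x) U. *)
Let colon_on (U : set B) :=
  forall x, tensU U x -> (forall c, C c -> F (iA c * x)) -> CF x.

Let is_ideal_F : is_ideal F.
Proof. exact: is_ideal_product_filtration. Qed.

Let is_ideal_CF : is_ideal CF.
Proof. by apply: is_ideal_product_filtration => // i; apply: is_ideal_colon. Qed.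

(** When b is not in U, a linear form killing U with value 1 at b maps
u + a (x) b to a, and F into A_(s - d), since it kills B_j for d < j <= s. *)
Let colon_on_line U d b : (d <= s)%N -> subspace U ->
  (forall j, (d < j <= s)%N -> B_ j `<=` U) -> B_ d b ->
  colon_on U ->
  colon_on [set x | exists u l, U u /\ x = u + kalg_map B l * b].
Proof.
move=> ds sU BU Bb colU.
have [kA kB _] := tensR.
have [Ub|nUb] := pselect (U b).
  move=> x Tx; apply: (colU x); apply: sub_tensors Tx => _ _ [u [l [Uu ->]]].
  by apply: subspaceD => //; apply: subspaceZ.
move=> x Tx xF.
have [T0 TD] := tensors_sum_closed iA iB (fun _ b => U b).
have [u [a [Uu xE]]] : exists u a, tensU U u /\ x = u + iA a * iB b.
  move: x Tx {xF}; apply: tensors_ind.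
    split; first by exists 0, 0; split=> //; rewrite rmorph0; ring.
    move=> _ _ [u [a [Uu ->]]] [v [a' [Uv ->]]].
    exists (u + v), (a + a'); split; first exact: TD.
    by rewrite rmorphD; ring.
  move=> a _ [u [l [Uu ->]]]; exists (iA a * iB u), (kalg_map A l * a).
  split; first exact: tensors_pure.
  by rewrite rmorphD !rmorphM kA kB; ring.
have [phi [phiL phib phiU]] := functional_exists b sU nUb.
have [g [gD gM gE]] := slice_exists tensR phiL.
have g0 : g 0 = 0 by have := gM 0 0; rewrite mulr0 mul0r.
have gU : tensU U `<=` [set y | g y = 0].
  apply: tensors_ind.
    by split=> [|y z /= gy gz]; rewrite /= ?gD ?gy ?gz ?addr0.
  by move=> a' b' Ub' /=; rewrite gE phiU // rmorph0 mul0r.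
have [As0 AsD AsM] := idA (s - d).
have gF : F `<=` [set y | A_ (s - d)%N (g y)].
  apply: tensors_ind.
    by split=> [|y z /= gy gz]; rewrite /= ?g0 // gD; apply: AsD.
  move=> a' b' [i [j [ij Aa' Bb']]] /=; rewrite gE.
  have [jd|dj] := leqP j d.
    by apply: AsM; apply: A_decr Aa'; rewrite -ij leq_subLR (addnC d) leq_add2l.
  rewrite phiU ?rmorph0 ?mul0r //; apply: BU Bb'.
  by rewrite dj -ij leq_addl.
(* Apply g to c x = c u + (c a) (x) b, which lies in F for c in C. *)
have Aa : CA (s - d)%N a.
  move=> c Cc; have := gF _ (xF c Cc); rewrite /= gM xE gD (gU _ Uu) add0r gE.
  by rewrite phib rmorph1 mul1r mulrC.
have [_ CFD _] := is_ideal_CF.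
rewrite xE; apply: CFD; last first.
  by apply: tensors_pure; exists (s - d)%N, d; split=> //; rewrite subnK.
apply: (colU u Uu) => c Cc.
have -> : iA c * u = iA c * x - iA (a * c) * iB b.
  by rewrite xE rmorphM; ring.
apply: (ideal_sub _ _ is_ideal_F); first exact: xF.
apply: tensors_pure; exists (s - d)%N, d; split=> //; first by rewrite subnK.
exact: Aa.
Qed.

(** An element of A (x) B_d involves finitely many vectors of B_d, which are
added to W one by one. *)
Let colon_on_step (W : set B) d : (d <= s)%N -> subspace W -> W `<=` B_ d ->
  (forall j, (d < j <= s)%N -> B_ j `<=` W) -> colon_on W -> colon_on (B_ d).
Proof.
move=> ds sW WB BW colW x Tx xF.
pose good U := [/\ subspace U, W `<=` U & colon_on U].
suff ext U : good U -> exists U', [/\ good U', U `<=` U' & tensU U' x].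
  have [U [[_ _ colU] _ Ux]] := ext W (And3 sW (@subset_refl _ W) colW).
  exact: colU x Ux xF.
move: x Tx U {xF}; apply: tensors_ind.
  split=> [U gU|x y IHx IHy U gU].
    by exists U; split=> //; case: (tensors_sum_closed iA iB (fun _ b => U b)).
  have [U1 [gU1 UU1 Tx]] := IHx _ gU.
  have [U2 [gU2 U12 Ty]] := IHy _ gU1.
  exists U2; split=> //; first exact: subset_trans UU1 U12.
  have [_ TD] := tensors_sum_closed iA iB (fun _ b => U2 b).
  by apply: TD => //; apply: sub_tensors Tx => _ b' /U12.
move=> a b Bb U [sU WU colU].
pose U' := [set x | exists u l, U u /\ x = u + kalg_map B l * b].
have UU' : U `<=` U' by move=> u Uu; exists u, 0; rewrite rmorph0 mul0r addr0.
exists U'; split=> //; last first.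
  apply: tensors_pure; exists 0, 1; rewrite rmorph1 mul1r add0r.
  by split=> //; case: sU.
split; [exact: subspace_line | exact: subset_trans UU' |].
by apply: (colon_on_line ds) => // j dj; apply: subset_trans WU; apply: BW.
Qed.

(** If C x lies in the sum of the A_i B_j with i + j = s, then x lies in the sum
of the (A_i : C) B_j: the subspace grows from 0 to B_s, then to B_(s - 1), and
so on up to B_0 = B. *)
Lemma colon_product_filtration x :
  (forall c, C c -> F (iA c * x)) -> CF x.
Proof.
have col d : (d <= s)%N -> colon_on (B_ (s - d)).
  elim: d => [|d IHd] ds.
    rewrite subn0; have [B0 _ _] := idB s.
    apply: (@colon_on_step [set 0]) => //.
    - by split=> // c _ _ /= -> ->; rewrite mulr0 addr0.
    - by move=> _ ->.
    - by move=> j /andP[sj js]; have := leq_trans sj js; rewrite ltnn.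
    - have [CF0 CFD _] := is_ideal_CF.
      move=> y Ty _; move: y Ty; apply: tensors_ind; first by [].
      by move=> a _ ->; rewrite rmorph0 mulr0.
  apply: (@colon_on_step (B_ (s - d)%N)).
  - exact: leq_subr.
  - exact: ideal_subspace.
  - by apply: B_decr; lia.
  - by move=> j /andP[sj _]; apply: B_decr; lia.
  - by apply: IHd; apply: ltnW.
apply: (col s (leqnn s)); rewrite subnn B_0.
by apply: sub_tensors (tensors_all tensR x).
Qed.

End ColonLeft.

Arguments colon_product_filtration {k A B R iA iB} tensR {A_ B_ s C}.

(** * Exchanging the two factors *)

Section Swap.
Variables (k : fieldType) (A B R : comKAlg k).
Variables (iA : {rmorphism A -> R}) (iB : {rmorphism B -> R}).

Lemma is_tensor_product_sym : is_tensor_product iA iB -> is_tensor_product iB iA.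
Proof.
move=> [kA kB univ]; split=> // M f [fL fR].
have [|g [[gL gE] uniq_g]] := univ M (fun a b => f b a); first by split.
exists g; split; first by split=> // b a; rewrite mulrC gE.
by move=> h [hL hE]; apply: uniq_g; split=> // a b; rewrite mulrC hE.
Qed.

Lemma tensors_sym (P : A -> B -> Prop) :
  tensors iA iB P = tensors iB iA (fun b a => P a b).
Proof.
by apply/seteqP; split; apply: tensors_ind => [|? ? ?];
  first [exact: tensors_sum_closed | rewrite mulrC; exact: tensors_pure].
Qed.

Lemma tensors_product_filtration_sym (A_ : nat -> set A) (B_ : nat -> set B) s :
  tensors iA iB (product_filtration A_ B_ s) =
  tensors iB iA (product_filtration B_ A_ s).
Proof.
rewrite tensors_sym; apply/seteqP.
split; apply: sub_tensors => b a [i [j [ij ? ?]]];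
  by exists j, i; rewrite addnC.
Qed.

End Swap.

(** * Powers of sums and products of extended ideals *)

Section ExtendedIdeals.
Variables (k : fieldType) (A B R : comKAlg k).
Variables (iA : {rmorphism A -> R}) (iB : {rmorphism B -> R}).
Hypothesis tensR : is_tensor_product iA iB.
Implicit Types (I K : set A) (J L : set B).

Lemma mem_ideal_ext (S T : comPzRingType) (f : {rmorphism S -> T}) (I : set S) x :
  I x -> ideal_ext f I (f x).
Proof. by move=> Ix; apply: mem_ideal_gen; exists x. Qed.

Lemma idealX_rmorph (S T : comPzRingType) (f : {rmorphism S -> T})
    (I : set S) (D : set T) n :
  (forall x, I x -> D (f x)) -> forall x, idealX I n x -> idealX D n (f x).
Proof.
move=> ID; elim: n => [//|n IHn] x.
have [D0 DD DM] := is_ideal_idealX D n.+1.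
move: x; apply: (@sub_idealM _ _ _ [set x | idealX D n.+1 (f x)]).
  split=> [|x y /= ? ?|a x /= ?]; first by rewrite /= rmorph0.
    by rewrite rmorphD; apply: DD.
  by rewrite rmorphM; apply: DM.
by move=> x y Ix nx /=; rewrite rmorphM; apply: mem_idealM; [apply: ID | apply: IHn].
Qed.

Lemma ideal_ext_l I : is_ideal I ->
  ideal_ext iA I `<=` tensors iA iB (fun a _ => I a).
Proof.
move=> [_ _ IM]; apply: sub_ideal_gen.
  by apply: is_ideal_tensors => // *; apply: IM.
by move=> _ [a Ia <-]; rewrite -[iA a]mulr1 -(rmorph1 iB); apply: tensors_pure.
Qed.

Lemma ideal_ext_r J : is_ideal J ->
  ideal_ext iB J `<=` tensors iA iB (fun _ b => J b).
Proof.
move=> [_ _ JM]; apply: sub_ideal_gen.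
  by apply: is_ideal_tensors => // *; apply: JM.
by move=> _ [b Jb <-]; rewrite -[iB b]mul1r -(rmorph1 iA); apply: tensors_pure.
Qed.

Lemma idealM_ext I J : is_ideal I -> is_ideal J ->
  idealM (ideal_ext iA I) (ideal_ext iB J) =
  tensors iA iB (fun a b => I a /\ J b).
Proof.
move=> idI idJ; have [[_ _ IM] [_ _ JM]] := (idI, idJ); apply/seteqP; split.
  apply: sub_idealM => [|x y Ix Jy].
    by apply: is_ideal_tensors => // a b a' b' [Ia Jb]; split; [apply: IM | apply: JM].
  apply: tensorsM (ideal_ext_l idI Ix) (ideal_ext_r idJ Jy).
  by move=> a b a' b' Ia Jb'; split; [rewrite mulrC; apply: IM | apply: JM].
apply: tensors_ind; first exact/ideal_sum_closed/ideal_gen_is_ideal.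
by move=> a b [Ia Jb]; apply: mem_idealM; apply: mem_ideal_ext.
Qed.

Lemma idealX_idealD_ext I J n : is_ideal I -> is_ideal J ->
  idealX (idealD (ideal_ext iA I) (ideal_ext iB J)) n `<=`
  tensors iA iB (product_filtration (idealX I) (idealX J) n).
Proof.
move=> idI idJ; elim: n => [|n IHn].
  by move=> x _; apply: sub_tensors (tensors_all tensR x) => a b _; exists 0%N, 0%N.
have idF m := is_ideal_product_filtration _ _ m tensR
  (is_ideal_idealX I) (is_ideal_idealX J).
apply: sub_idealM => // _ y [u Iu [v Jv <-]] /IHn ny.
have [_ FD _] := idF n.+1; rewrite mulrDl; apply: FD.
  apply: tensorsM (ideal_ext_l idI Iu) ny => a b a' b' Ia [i [j [ij Ia' Jb']]].
  exists i.+1, j; split; [by rewrite addSn ij | exact: mem_idealM |].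
  by have [_ _] := is_ideal_idealX J j; apply.
apply: tensorsM (ideal_ext_r idJ Jv) ny => a b a' b' Jb [i [j [ij Ia' Jb']]].
exists i, j.+1; split; [by rewrite addnS ij | | exact: mem_idealM].
by have [_ _] := is_ideal_idealX I i; apply.
Qed.

Lemma mem_idealX_idealD_ext I J i j a b : idealX I i a -> idealX J j b ->
  idealX (idealD (ideal_ext iA I) (ideal_ext iB J)) (i + j) (iA a * iB b).
Proof.
have [I0 _ _] := ideal_gen_is_ideal (iA @` I).
have [J0 _ _] := ideal_gen_is_ideal (iB @` J).
move=> Ia Jb; apply: mem_idealX_mul.
  apply: idealX_rmorph Ia => x Ix; exists (iA x); first exact: mem_ideal_ext.
  by exists 0; rewrite ?addr0.
apply: idealX_rmorph Jb => x Jx; exists 0 => //.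
by exists (iB x); rewrite ?add0r //; apply: mem_ideal_ext.
Qed.

Lemma idealX_idealM_ext K L n : is_ideal K -> is_ideal L ->
  idealX (idealM (ideal_ext iA K) (ideal_ext iB L)) n `<=`
  tensors iA iB (fun a b => idealX K n a /\ idealX L n b).
Proof.
move=> idK idL; elim: n => [|n IHn].
  by move=> x _; apply: sub_tensors (tensors_all tensR x).
have [[_ _ KM] [_ _ LM]] := (is_ideal_idealX K n.+1, is_ideal_idealX L n.+1).
apply: sub_idealM => [|x y].
  by apply: is_ideal_tensors => // a b a' b' [? ?]; split; [apply: KM | apply: LM].
move=> + /IHn ny; rewrite idealM_ext // => KLx; apply: tensorsM KLx ny.
by move=> a b a' b' [Ka Lb] [Ka' Lb']; split; apply: mem_idealM.
Qed.

Lemma mem_idealX_idealM_ext K L n a b : idealX K n a -> idealX L n b ->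
  idealX (idealM (ideal_ext iA K) (ideal_ext iB L)) n (iA a * iB b).
Proof.
elim: n a b => [//|n IHn] a b + Lb.
have [S0 SD SM] := is_ideal_idealX (idealM (ideal_ext iA K) (ideal_ext iB L)) n.+1.
set S := idealX _ n.+1 in S0 SD SM *.
move: a; apply: (@sub_idealM _ _ _ [set a | S (iA a * iB b)]).
  split=> [|x y /= ? ?|c x /= ?]; first by rewrite /= rmorph0 mul0r.
    by rewrite rmorphD mulrDl; apply: SD.
  by rewrite rmorphM -mulrA; apply: SM.
move=> a a' Ka Ka' /=; move: b Lb.
apply: (@sub_idealM _ _ _ [set b | S (iA (a * a') * iB b)]).
  split=> [|x y /= ? ?|c x /= ?]; first by rewrite /= rmorph0 mulr0.
    by rewrite rmorphD mulrDr; apply: SD.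
  by rewrite [iB _]rmorphM mulrCA; apply: SM.
move=> b b' Lb Lb' /=; rewrite !rmorphM mulrACA.
by apply: mem_idealM; [apply: mem_idealM; apply: mem_ideal_ext | apply: IHn].
Qed.

(** * Saturated powers *)

(** The colon by (KL)^t is split into one by L^t and one by K^t. *)
Lemma saturated_power_sub I K J L s : is_ideal I -> is_ideal K ->
    is_ideal J -> is_ideal L ->
  saturated_power (idealD (ideal_ext iA I) (ideal_ext iB J))
                  (idealM (ideal_ext iA K) (ideal_ext iB L)) s `<=`
  tensors iA iB (product_filtration (saturated_power I K) (saturated_power J L) s).
Proof.
move=> idI idK idJ idL x [t t1 xC].
have colT (S : comPzRingType) (N : set S) : ideal_colon setT N = setT.
  by apply/seteqP; split.
have colS (S : comPzRingType) (M N : set S) m n : (m <= n)%N ->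
    ideal_colon (idealX M n) N `<=` ideal_colon (idealX M m) N.
  by move=> mn y yC z Nz; apply: idealX_sub mn _ (yC z Nz).
pose CK i := ideal_colon (idealX I i) (idealX K t).
pose CL j := ideal_colon (idealX J j) (idealX L t).
suff xF : tensors iA iB (product_filtration CK CL s) x.
  apply: sub_tensors xF => a b [i [j [ij Ia Jb]]].
  by exists i, j; split=> //; exists t.
rewrite tensors_product_filtration_sym.
(* The colon by L^t comes first, with A and B exchanged and the filtration
   I^i : K^t on the A-side; the colon by K^t is then applied to each d x. *)
apply: (colon_product_filtration (is_tensor_product_sym tensR)).
- exact: is_ideal_idealX.
- by move=> i; apply/is_ideal_colon/is_ideal_idealX.
- exact: idealX_sub.
- exact: colS.
- exact: colT.
move=> d Ld; rewrite -tensors_product_filtration_sym.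
apply: (colon_product_filtration tensR).
- exact: is_ideal_idealX.
- exact: is_ideal_idealX.
- exact: idealX_sub.
- exact: idealX_sub.
- by [].
move=> c Kc; apply: idealX_idealD_ext => //.
by rewrite mulrA mulrC; apply: xC; apply: mem_idealX_idealM_ext.
Qed.

Lemma mem_saturated_power I K J L i j a b : is_ideal K -> is_ideal L ->
    saturated_power I K i a -> saturated_power J L j b ->
  saturated_power (idealD (ideal_ext iA I) (ideal_ext iB J))
    (idealM (ideal_ext iA K) (ideal_ext iB L)) (i + j) (iA a * iB b).
Proof.
move=> idK idL [t t1 aC] [u u1 bC]; exists (maxn t u).
  by rewrite /= leq_max (t1 : (1 <= t)%N).
move=> y /(idealX_idealM_ext _ idK idL).
have [S0 SD _] := is_ideal_idealX (idealD (ideal_ext iA I) (ideal_ext iB J)) (i + j).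
move: y; apply: (@tensors_ind _ _ _ _ _ _ _ [set y | idealX _ (i + j) (iA a * iB b * y)]).
  by split=> [|x y /= ? ?]; rewrite /= ?mulr0 ?mulrDr //; apply: SD.
move=> c d [Kc Ld] /=; rewrite mulrACA -!rmorphM; apply: mem_idealX_idealD_ext.
  by apply: aC; apply: idealX_sub Kc; rewrite leq_maxl.
by apply: bC; apply: idealX_sub Ld; rewrite leq_maxr.
Qed.

End ExtendedIdeals.

Unset Implicit Arguments.

Theorem theorem3p7 (k : fieldType) (A B R : comKAlg k)
  (iA : {rmorphism A -> R}) (iB : {rmorphism B -> R})
  (tensR : is_tensor_product iA iB)
  (noethA : noetherian A) (noethB : noetherian B) (noethR : noetherian R)
  (I K : set A) (J L : set B)
  (idI : is_ideal I) (idK : is_ideal K) (idJ : is_ideal J) (idL : is_ideal L)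
  (s : nat) (s_ge1 : (1 <= s)%N) :
  saturated_power (idealD (ideal_ext iA I) (ideal_ext iB J))
                  (idealM (ideal_ext iA K) (ideal_ext iB L)) s
  = \big[@idealD R/[set 0]]_(i < s.+1)
      idealM (ideal_ext iA (saturated_power I K i))
             (ideal_ext iB (saturated_power J L (s - i))).
Proof.
have idS := is_ideal_saturated_power.
have idG (i : 'I_s.+1) : is_ideal (idealM (ideal_ext iA (saturated_power I K i))
    (ideal_ext iB (saturated_power J L (s - i)))).
  exact: ideal_gen_is_ideal.
apply/seteqP; split.
  move=> x /(saturated_power_sub tensR idI idK idJ idL); move: x.
  apply: tensors_ind; first exact/ideal_sum_closed/is_ideal_big_idealD.
  move=> a b [i [j [ij Ia Jb]]].
  have i_s : (i < s.+1)%N by rewrite -ij ltnS leq_addr.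
  apply: (sub_big_idealD _ idG (Ordinal i_s)).
  by apply: mem_idealM; apply: mem_ideal_ext => //=; rewrite -ij addKn.
apply: big_idealD_sub => // i; rewrite idealM_ext //.
apply: tensors_ind; first exact: ideal_sum_closed.
move=> a b [Ia Jb]; rewrite -[s in X in X _](@subnKC i s) -1?ltnS //.
exact: mem_saturated_power.
Qed.
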